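(* Let $\Omega=(a,b)$ be divided into $N>1$ elements $\Omega_l=(x_{l-1},x_l)$, $l=1,\dots,N$, of equal length, with $N$ proportional to the polynomial order $W$. Let $0<\epsilon\le1$ and $\mathcal{L}u=-\epsilon^2u''+u$. Then there exists a constant $C_\epsilon>0$, depending on $\epsilon$, such that for every $\{u_l\}_l\in\mathcal{S}^W(\Omega)$, $$\sum_{l=1}^N\|u_l\|_{2,\epsilon,\Omega_l}^2\le C_\epsilon\,\mathcal{V}_{hp}^W(\{u_l\}_l),$$ where $$\mathcal{V}_{hp}^W(\{u_l\}_l)=\sum_{l=1}^N\|\mathcal{L}u_l\|_{L^2(\Omega_l)}^2+\sum_{l=1}^{N-1}\left(|[u(x_l)]|^2+\left|\left[\tfrac{du}{dx}(x_l)\right]\right|^2\right)+|u(a)|^2+|u(b)|^2,$$ provided $W=O\left(\tfrac1\epsilon\right)$.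
   Context: $\Omega=(a,b)$ is a bounded open interval, $a=x_0<x_1<\dots<x_N=b$ with $x_l-x_{l-1}=(b-a)/N$. ''$N$ proportional to $W$'' means $N=\kappa W$ with a fixed constant $\kappa>0$. $\mathcal{S}^W(\Omega)$ is the space of families $\{u_l\}_{l=1}^N$ where $u_l$ is a polynomial of degree at most $W$ on $\Omega_l$; no continuity between elements is imposed. Jumps: $[u(x_l)]=u_l(x_l)-u_{l+1}(x_l)$, $\left[\frac{du}{dx}(x_l)\right]=u_l'(x_l)-u_{l+1}'(x_l)$; also $u(a)=u_1(a)$, $u(b)=u_N(b)$. The parameter-dependent norm on an interval $J$ is $$\|v\|_{2,\epsilon,J}^2=\sum_{j=0}^{2}\epsilon^{2j}\left\|\frac{d^jv}{dx^j}\right\|_{L^2(J)}^2.$$ The condition $W=O(1/\epsilon)$ is in the usual Landau sense: $W\le c_0/\epsilon$ for a fixed constant $c_0$. The constant $C_\epsilon$ may depend on $c_0$, $\kappa$ and $\Omega$. *)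

(* Defs.v *)
From HB Require Import structures.
From mathcomp Require Import all_boot all_order all_algebra.
From mathcomp Require Import all_classical all_reals all_analysis.
Set Implicit Arguments.
Unset Strict Implicit.
Unset Printing Implicit Defensive.
Import Order.TTheory GRing.Theory Num.Theory.
Import numFieldNormedType.Exports.

Local Open Scope classical_set_scope.
Local Open Scope ring_scope.

Definition node (R : realType) (a b : R) (N l : nat) : R :=
  a + l%:R * ((b - a) / N%:R).

(* Elements are numbered 1..N, so that the l-th one is (x_(l-1), x_l). *)
Definition element (R : realType) (a b : R) (N l : nat) : set R :=
  `]node a b N l.-1, node a b N l[.

(* A family {u_l} with l = 1..N is encoded as a sequence of polynomials, of
   which only the terms of index 1..N are ever used. *)
Definition spectral_space (R : realType) (W N : nat) : set (nat -> {poly R}) :=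
  [set u | forall l, (1 <= l <= N)%N -> (size (u l) <= W.+1)%N].

Definition L2norm (R : realType) (J : set R) (v : R -> R) : \bar R :=
  ('N[lebesgue_measure]_2%:E[EFin \o (v \_ J)])%E.

Definition sqnorm2eps (R : realType) (eps : R) (J : set R) (v : R -> R)
    : \bar R :=
  (\sum_(0 <= j < 3) (eps ^+ (2 * j))%:E * L2norm J (v^`(j))%classic ^+ 2)%E.

Definition Lop (R : realType) (eps : R) (v : R -> R) : R -> R :=
  fun x => - eps ^+ 2 * (v^`(2))%classic x + v x.

Definition jump (R : realType) (u : nat -> {poly R}) (l : nat) (x : R) : R :=
  (u l).[x] - (u l.+1).[x].

Definition djump (R : realType) (u : nat -> {poly R}) (l : nat) (x : R) : R :=
  (horner (u l))^`()%classic x - (horner (u l.+1))^`()%classic x.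

Definition Vhp (R : realType) (a b eps : R) (N : nat) (u : nat -> {poly R})
    : \bar R :=
  (\sum_(1 <= l < N.+1)
      L2norm (element a b N l) (Lop eps (horner (u l))) ^+ 2
   + (\sum_(1 <= l < N)
        (`|jump u l (node a b N l)| ^+ 2 + `|djump u l (node a b N l)| ^+ 2)
      + `|(u 1%N).[a]| ^+ 2 + `|(u N).[b]| ^+ 2)%:E)%E.

(* Main.v *)
Require Import Defs.
From HB Require Import structures.
From mathcomp Require Import all_boot all_order all_algebra.
From mathcomp Require Import all_classical all_reals all_analysis.
From mathcomp Require Import ring lra.
Import Order.TTheory GRing.Theory Num.Theory.
Import numFieldNormedType.Exports.
Local Open Scope classical_set_scope.
Local Open Scope ring_scope.

(**
On one element (x, y), expanding the square of f = L v = v - eps^2 v'' and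
using (v' v)' = v'^2 + v'' v gives the exact identity
  ||v||^2 + 2 eps^2 ||v'||^2 + eps^4 ||v''||^2
    = ||f||^2 + 2 eps^2 (v'(y) v(y) - v'(x) v(x)).
Summed over the elements, the boundary terms regroup into products of a jump
(or an end value) with a one-sided trace. By Young's inequality they are at
most delta * (sum of squared traces) + 1/delta * (squared jumps and end
values); a trace inequality, whose constant depends on eps and on a lower bound
for the element length, absorbs the first part into the left-hand side. The
element length is bounded below because N = kappa W <= kappa c0 / eps; the
polynomial degree plays no other role.
*)

(** * Integrals of polynomials over an open interval *)

Definition pint {R : realType} (x y : R) (p : {poly R}) : R :=
  \int[lebesgue_measure]_(t in `]x, y[) p.[t].

Lemma integrable_horner (R : realType) (x y : R) (p : {poly R}) :
  lebesgue_measure.-integrable `]x, y[ (EFin \o horner p).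
Proof.
apply: (@integrableS _ _ _ lebesgue_measure `[x, y]%classic) => //.
  exact: subset_itv_oo_cc.
apply: continuous_compact_integrable; first exact: segment_compact.
exact/continuous_subspaceT/continuous_horner.
Qed.

Lemma le_pint (R : realType) (x y : R) (p q : {poly R}) :
  (forall t, x < t < y -> p.[t] <= q.[t]) -> pint x y p <= pint x y q.
Proof.
by move=> le_pq; apply: le_Rintegral => //; exact: integrable_horner.
Qed.

Lemma pintD (R : realType) (x y : R) (p q : {poly R}) :
  pint x y (p + q) = pint x y p + pint x y q.
Proof.
rewrite /pint -RintegralD//; try exact: integrable_horner.
by apply: eq_Rintegral => t _; rewrite hornerD.
Qed.

Lemma pintZ (R : realType) (x y c : R) (p : {poly R}) :
  pint x y (c *: p) = c * pint x y p.
Proof.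
rewrite /pint -RintegralZl//; try exact: integrable_horner.
by apply: eq_Rintegral => t _; rewrite hornerZ.
Qed.

Lemma pint_sqr_ge0 (R : realType) (x y : R) (p : {poly R}) :
  0 <= pint x y (p ^+ 2).
Proof. by apply: Rintegral_ge0 => t _; rewrite horner_exp sqr_ge0. Qed.

Lemma pint_deriv (R : realType) (x y : R) (p : {poly R}) :
  x < y -> pint x y p^`() = p.[y] - p.[x].
Proof.
move=> xy; rewrite /pint /Rintegral.
(* The endpoints have measure zero, so the integral can be moved to the closed interval, where the
   fundamental theorem of calculus applies. *)
rewrite -(@integral_itv_bndoo _ _ _ _ true false); last first.
  by have /integrableP[] := @integrable_horner R x y p^`().
rewrite (@continuous_FTC2 _ _ (horner p)) //.
- exact/continuous_subspaceT/continuous_horner.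
- split => [t _||]; first exact: derivable_horner.
  + exact/cvg_at_right_filter/continuous_horner.
  + exact/cvg_at_left_filter/continuous_horner.
- by move=> t _; rewrite derivE.
Qed.

(** Bridge from the extended-real norms of the statement to [pint]: once it is applied, every
    estimate takes place in [R]. *)
Lemma L2norm_horner (R : realType) (x y : R) (p : {poly R}) :
  (L2norm `]x, y[ (horner p) ^+ 2 = (pint x y (p ^+ 2))%:E)%E.
Proof.
have -> : (L2norm `]x, y[ (horner p) ^+ 2 =
          \int[lebesgue_measure]_(t in `]x, y[) ((p ^+ 2).[t])%:E)%E.
  have -> (z : \bar R) : (0 <= z -> z ^+ 2 = z `^ 2)%E; last exact: Lnorm_ge0.
    case: z => [r|_|] //; first by rewrite lee_fin poweR_EFin => /powR_mulrn ->.
    by rewrite expe2 mulyy poweRyr ?pnatr_eq0.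
  rewrite poweR_Lnorm ?pnatr_eq0//.
  rewrite [RHS]integral_mkcond; apply: eq_integral => t _ /=.
  rewrite powR_mulrn// /restrict /patch; case: ifP => _ /=.
    by rewrite horner_exp real_normK// num_real.
  by rewrite normr0 expr0n.
rewrite fineK//; apply: integrable_fin_num => //.
exact: (integrable_horner _ _ _ (p ^+ 2)).
Qed.

Lemma derive1n_horner (R : realType) (p : {poly R}) (n : nat) :
  (horner p)^`(n)%classic = horner p^`(n).
Proof.
elim: n => [|n IH]; first by rewrite derivn0 derive1n0.
by rewrite derive1nS IH derivnS; apply/funext => t; rewrite derivE.
Qed.

(** * Traces and energy on one element *)

Lemma trace_right (R : realType) (x y : R) (v : {poly R}) : x < y ->
  (y - x) * v.[y] ^+ 2 <=
  (1 + (y - x)) * pint x y (v ^+ 2) + (y - x) * pint x y (v^`() ^+ 2).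
Proof.
move=> xy.
(* The weight [t - x] vanishes at [x], so integrating the derivative leaves only the value at
   [y]. *)
have -> : (y - x) * v.[y] ^+ 2 = pint x y (('X - x%:P) * v ^+ 2)^`().
  by rewrite pint_deriv// !(horner_exp, hornerM, hornerXsubC); ring.
rewrite -!pintZ -pintD; apply: le_pint => t /andP[xt ty].
rewrite derivM derivXsubC mul1r expr2 derivM -expr2 [v^`() * v]mulrC -mulr2n.
rewrite !(horner_exp, hornerXsubC, hornerD, hornerMn, hornerM, hornerZ).
set p := v.[t]; set q := v^`().[t].
(* The integrand on the left is [p ^+ 2 + 2 * (t - x) * p * q]. The two squares bound [2 * p * q] in
   absolute value by [p ^+ 2 + q ^+ 2], and [0 < t - x < y - x]. *)
have ? := sqr_ge0 (p + q); have ? := sqr_ge0 (p - q).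
nra.
Qed.

(** Mirror image of [trace_right], with the weight [t - y] that vanishes at the right end. *)
Lemma trace_left (R : realType) (x y : R) (v : {poly R}) : x < y ->
  (y - x) * v.[x] ^+ 2 <=
  (1 + (y - x)) * pint x y (v ^+ 2) + (y - x) * pint x y (v^`() ^+ 2).
Proof.
move=> xy.
have -> : (y - x) * v.[x] ^+ 2 = pint x y (('X - y%:P) * v ^+ 2)^`().
  by rewrite pint_deriv// !(horner_exp, hornerM, hornerXsubC); ring.
rewrite -!pintZ -pintD; apply: le_pint => t /andP[xt ty].
rewrite derivM derivXsubC mul1r expr2 derivM -expr2 [v^`() * v]mulrC -mulr2n.
rewrite !(horner_exp, hornerXsubC, hornerD, hornerMn, hornerM, hornerZ).
set p := v.[t]; set q := v^`().[t].
have ? := sqr_ge0 (p + q); have ? := sqr_ge0 (p - q).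
nra.
Qed.

Lemma pint_energy (R : realType) (x y eps : R) (v : {poly R}) : x < y ->
  pint x y (v ^+ 2) + 2 * eps ^+ 2 * pint x y (v^`() ^+ 2)
    + eps ^+ 4 * pint x y (v^`(2) ^+ 2)
  = pint x y ((v - eps ^+ 2 *: v^`(2)) ^+ 2)
    + 2 * eps ^+ 2 * (v^`().[y] * v.[y] - v^`().[x] * v.[x]).
Proof.
move=> xy.
(* Once the boundary term is the integral of a total derivative, only an identity between the
   polynomial integrands remains. *)
have -> : v^`().[y] * v.[y] - v^`().[x] * v.[x] = pint x y (v^`() * v)^`().
  by rewrite pint_deriv// !hornerM.
rewrite -!pintZ -!pintD; congr pint.
rewrite derivM -[v^`()^`()]/v^`(2) -!mul_polyC (exprD eps 2 2).
move: (eps ^+ 2) => s; rewrite !polyCM [2%:P]polyCMn polyC1; ring.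
Qed.

(** Dividing the trace inequality by the element length produces the factor [H]. Since [eps <= 1],
    the smallest weight in [E] is [eps ^+ 4], whence the division by it. The second bound is the
    same inequality applied to the derivative of [v], and so draws on the second-order term of
    [E]. *)
Lemma trace_energy (R : realType) (x y eps H : R) (v : {poly R}) : x < y ->
  0 < eps -> eps <= 1 -> (y - x)^-1 + 1 <= H ->
  forall z, z = x \/ z = y ->
  let E := pint x y (v ^+ 2) + eps ^+ 2 * pint x y (v^`() ^+ 2)
    + eps ^+ 4 * pint x y (v^`(2) ^+ 2) in
  v.[z] ^+ 2 <= H / eps ^+ 4 * E /\ v^`().[z] ^+ 2 <= H / eps ^+ 4 * E.
Proof.
move=> xy e0 e1 leH z zE E.
have h0 : 0 < y - x by rewrite subr_gt0.
have traceH (w : {poly R}) :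
    w.[z] ^+ 2 <= H * pint x y (w ^+ 2) + H * pint x y (w^`() ^+ 2).
  rewrite -(ler_pM2l h0).
  apply: (@le_trans _ _ ((1 + (y - x)) * pint x y (w ^+ 2)
                         + (y - x) * pint x y (w^`() ^+ 2))).
    by case: zE => ->; [exact: trace_left | exact: trace_right].
  have leHh : 1 + (y - x) <= (y - x) * H.
    by rewrite -(ler_pM2l h0) mulrDr mulfV ?gt_eqF// mulr1 in leH.
  have := pint_sqr_ge0 _ x y w; have := pint_sqr_ge0 _ x y w^`().
  nra.
have e2_le1 : eps ^+ 2 <= 1 by rewrite expr_le1// ltW.
have H0 : 0 < H by apply: lt_le_trans leH; rewrite addr_gt0// invr_gt0.
have e2_gt0 : 0 < eps ^+ 2 by rewrite exprn_gt0.
have e4E : eps ^+ 4 = eps ^+ 2 * eps ^+ 2 by rewrite -exprD.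
have A0 := pint_sqr_ge0 _ x y v; have B0 := pint_sqr_ge0 _ x y v^`().
have D0 := pint_sqr_ge0 _ x y v^`(2).
rewrite /E; split; rewrite mulrAC ler_pdivlMr ?exprn_gt0//.
  apply: (le_trans (ler_wpM2r _ (traceH v))); first exact/exprn_ge0/ltW.
  rewrite -mulrDr -mulrA ler_pM2l// e4E.
  move: e2_le1 e2_gt0 A0 B0 D0; move: (pint _ _ (v ^+ 2)) => A.
  move: (pint _ _ (v^`() ^+ 2)) (pint _ _ (v^`(2) ^+ 2)) (eps ^+ 2) => B D s.
  move=> s1 s0 A0 B0 D0; have ss : s * s <= s by nra.
  nra.
apply: (le_trans (ler_wpM2r _ (traceH v^`()))); first exact/exprn_ge0/ltW.
rewrite -mulrDr -mulrA ler_pM2l// -[v^`()^`()]/v^`(2) e4E.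
move: e2_le1 e2_gt0 A0 B0 D0; move: (pint _ _ (v ^+ 2)) => A.
move: (pint _ _ (v^`() ^+ 2)) (pint _ _ (v^`(2) ^+ 2)) (eps ^+ 2) => B D s.
move=> s1 s0 A0 B0 D0; have ss : s * s <= s by nra.
nra.
Qed.

(** * Regrouping the boundary terms at the nodes *)

Lemma ler_2M_young (R : realFieldType) (d x y : R) : 0 < d ->
  2 * (x * y) <= d * x ^+ 2 + d^-1 * y ^+ 2.
Proof.
move=> d0.
have -> : d * x ^+ 2 + d^-1 * y ^+ 2 = d * (x - d^-1 * y) ^+ 2 + 2 * (x * y).
  by field; rewrite gt_eqF.
by rewrite lerDr mulr_ge0 ?sqr_ge0// ltW.
Qed.

(** Here [p] stands for values and [q] for derivatives, at the left ([l]) or right ([r]) end of an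
    element. At an interior node, with primes for the next element, [qr pr - ql' pl' = pr (qr - ql')
    + ql' (pr - pl')], and Young's inequality applies to each product. *)
Lemma sum_boundary_le (R : realFieldType) (d : R) (pl ql pr qr : nat -> R)
    (N : nat) : 0 < d -> (0 < N)%N ->
  2 * (\sum_(1 <= l < N.+1) (qr l * pr l - ql l * pl l)) <=
  d * (\sum_(1 <= l < N.+1) (pl l ^+ 2 + ql l ^+ 2 + pr l ^+ 2 + qr l ^+ 2))
  + d^-1 * (\sum_(1 <= l < N) ((pr l - pl l.+1) ^+ 2 + (qr l - ql l.+1) ^+ 2)
            + pl 1%N ^+ 2 + pr N ^+ 2).
Proof.
move=> d0; have di0 : 0 < d^-1 by rewrite invr_gt0.
case: N => // M _.
(* Induction form: the product at the right end of the last element is set aside, and the squares of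
   its two traces are held back for the next node. *)
suff : 2 * (\sum_(1 <= l < M.+2) (qr l * pr l - ql l * pl l)) <=
    2 * (qr M.+1 * pr M.+1) +
    d * (\sum_(1 <= l < M.+2) (pl l ^+ 2 + ql l ^+ 2 + pr l ^+ 2 + qr l ^+ 2)
         - pr M.+1 ^+ 2 - qr M.+1 ^+ 2)
    + d^-1 * (\sum_(1 <= l < M.+1)
                 ((pr l - pl l.+1) ^+ 2 + (qr l - ql l.+1) ^+ 2) + pl 1%N ^+ 2).
  have := ler_2M_young _ _ (qr M.+1) (pr M.+1) d0.
  have := mulr_ge0 (ltW d0) (sqr_ge0 (pr M.+1)).
  lra.
elim: M => [|M IH].
  rewrite !big_nat1 big_geq//.
  have := ler_2M_young _ _ (ql 1%N) (- pl 1%N) d0.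
  have := mulr_ge0 (ltW d0) (sqr_ge0 (pl 1%N)).
  rewrite sqrrN; lra.
rewrite big_nat_recr// [X in d * (X - _ - _)]big_nat_recr//=.
rewrite [X in d^-1 * (X + _)]big_nat_recr//=.
have := ler_2M_young _ _ (ql M.+2) (pr M.+1 - pl M.+2) d0.
have := ler_2M_young _ _ (pr M.+1) (qr M.+1 - ql M.+2) d0.
have := mulr_ge0 (ltW d0) (sqr_ge0 (pl M.+2)).
have := mulr_ge0 (ltW d0) (sqr_ge0 (qr M.+1)).
lra.
Qed.

(** * The operator and the norm on polynomials *)

Lemma Lop_horner (R : realType) (eps : R) (v : {poly R}) :
  Lop eps (horner v) = horner (v - eps ^+ 2 *: v^`(2)).
Proof.
apply/funext => t; rewrite /Lop derive1n_horner hornerD hornerN hornerZ.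
by rewrite mulNr addrC.
Qed.

Lemma sqnorm2eps_horner (R : realType) (eps x y : R) (v : {poly R}) :
  sqnorm2eps eps `]x, y[ (horner v) =
  (pint x y (v ^+ 2) + eps ^+ 2 * pint x y (v^`() ^+ 2)
    + eps ^+ 4 * pint x y (v^`(2) ^+ 2))%:E.
Proof.
rewrite /sqnorm2eps.
under eq_bigr do rewrite derive1n_horner L2norm_horner -EFinM.
by rewrite sumEFin !big_nat_recr//= big_geq// add0r expr0 mul1r.
Qed.

(** * Summation over the elements *)

Section broken_energy.
Variables (R : realType) (a b eps : R) (N : nat) (u : nat -> {poly R}).

Let x l := node a b N l.
(** [Q l], [F l] and [J] are the real values of the squared element norm, the squared element
    residual, and the jump and end-value part of [Vhp]. *)
Let Q l := pint (x l.-1) (x l) (u l ^+ 2)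
  + eps ^+ 2 * pint (x l.-1) (x l) ((u l)^`() ^+ 2)
  + eps ^+ 4 * pint (x l.-1) (x l) ((u l)^`(2) ^+ 2).
Let F l := pint (x l.-1) (x l) ((u l - eps ^+ 2 *: (u l)^`(2)) ^+ 2).
Let J := \sum_(1 <= l < N)
    (`|jump u l (node a b N l)| ^+ 2 + `|djump u l (node a b N l)| ^+ 2)
  + `|(u 1%N).[a]| ^+ 2 + `|(u N).[b]| ^+ 2.

Lemma sum_energy_le (K : R) : a < b -> 0 < eps -> eps <= 1 -> (0 < N)%N ->
  (N%:R / (b - a) + 1) / eps ^+ 4 <= K ->
  \sum_(1 <= l < N.+1) Q l <= 16 * K * (\sum_(1 <= l < N.+1) F l + J).
Proof.
move=> ab e0 e1 N0 leK.
have ba0 : 0 < b - a by rewrite subr_gt0.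
have n0 : 0 < N%:R :> R by rewrite ltr0n.
have stepE l : (0 < l)%N -> x l - x l.-1 = (b - a) / N%:R.
  by case: l => // l _; rewrite /x /node /= -natr1; ring.
have step l : (0 < l)%N -> x l.-1 < x l.
  by move=> l0; rewrite -subr_gt0 stepE// divr_gt0.
have x0 : x 0 = a by rewrite /x /node mul0r addr0.
have xN : x N = b by rewrite /x /node mulrCA mulfV ?gt_eqF//; ring.
pose H := N%:R / (b - a) + 1.
have Hx l : (0 < l)%N -> (x l - x l.-1)^-1 + 1 <= H.
  by move=> l0; rewrite stepE// invf_div.
have K1 : 1 <= K.
  apply: le_trans leK; rewrite ler_pdivlMr ?exprn_gt0// mul1r.
  apply: (@le_trans _ _ 1); first by rewrite expr_le1// ltW.
  by rewrite lerDr divr_ge0// ltW.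
have K0 : 0 < K by apply: lt_le_trans K1.
have Q0 l : 0 <= Q l.
  by rewrite /Q !addr_ge0// ?mulr_ge0// ?exprn_ge0// ?pint_sqr_ge0// ltW.
pose pl l := (u l).[x l.-1]; pose ql l := (u l)^`().[x l.-1].
pose pr l := (u l).[x l]; pose qr l := (u l)^`().[x l].
(* The first-derivative term occurs once in [Q l] but twice in [pint_energy]; the surplus is
   nonnegative. *)
have QE l : (0 < l)%N ->
    Q l <= F l + 2 * eps ^+ 2 * (qr l * pr l - ql l * pl l).
  move=> l0; rewrite -pint_energy ?step//; rewrite /Q lerD2r lerD2l.
  by rewrite -mulrA ler_peMl ?ler1n// mulr_ge0 ?sqr_ge0 ?pint_sqr_ge0.
have traces l : (0 < l)%N ->
    pl l ^+ 2 + ql l ^+ 2 + pr l ^+ 2 + qr l ^+ 2 <= 4 * K * Q l.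
  move=> l0; have tr := trace_energy _ _ _ _ _ (u l) (step l l0) e0 e1 (Hx l l0).
  have [trl trl'] := tr _ (or_introl erefl).
  have [trr trr'] := tr _ (or_intror erefl).
  have QK : H / eps ^+ 4 * Q l <= K * Q l by rewrite ler_wpM2r.
  have := le_trans trl QK; have := le_trans trr QK.
  have := le_trans trl' QK; have := le_trans trr' QK.
  rewrite -/(pl l) -/(pr l) -/(ql l) -/(qr l); lra.
have JE : J = \sum_(1 <= l < N)
      ((pr l - pl l.+1) ^+ 2 + (qr l - ql l.+1) ^+ 2)
    + pl 1%N ^+ 2 + pr N ^+ 2.
  rewrite /J /pl /pr /= x0 xN !real_normK ?num_real//; congr (_ + _ + _).
  apply: eq_bigr => l _; rewrite /jump /djump !real_normK ?num_real//.
  by rewrite -!derivE.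
have J0 : 0 <= J.
  by rewrite /J !addr_ge0// sumr_ge0// => l _; rewrite addr_ge0.
have F0 : 0 <= \sum_(1 <= l < N.+1) F l.
  by apply: sumr_ge0 => l _; exact: pint_sqr_ge0.
(* With this Young parameter, [traces] bounds the weighted sum of squared traces by half of the
   total energy, at the price of a factor [8 * K] on [J]. *)
have d0 : 0 < (8 * K)^-1 by rewrite invr_gt0 mulr_gt0.
have := sum_boundary_le _ _ pl ql pr qr N d0 N0; rewrite -JE invrK.
set B := \sum_(1 <= l < N.+1) (_ - _) => leB.
have sumQ : \sum_(1 <= l < N.+1) Q l
    <= \sum_(1 <= l < N.+1) F l + eps ^+ 2 * (2 * B).
  rewrite mulrA [eps ^+ 2 * 2]mulrC mulr_sumr -big_split /=.
  by rewrite !big_nat; apply: ler_sum => l /andP[l0 _]; exact: QE.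
have sumT : (8 * K)^-1 * (\sum_(1 <= l < N.+1)
      (pl l ^+ 2 + ql l ^+ 2 + pr l ^+ 2 + qr l ^+ 2))
    <= 2^-1 * \sum_(1 <= l < N.+1) Q l.
  rewrite ler_pdivrMl ?mulr_gt0// mulrA.
  have -> : 8 * K * 2^-1 = 4 * K by field.
  rewrite mulr_sumr !big_nat.
  by apply: ler_sum => l /andP[l0 _]; exact: traces.
set S := \sum_(1 <= l < N.+1) Q l in sumQ sumT *.
have S0 : 0 <= S by apply: sumr_ge0.
have e2 : eps ^+ 2 * (2 * B) <= 2^-1 * S + 8 * K * J.
  have [B0|B0] := leP 0 (2 * B).
    apply: le_trans (le_trans leB _); last by rewrite lerD2r.
    by rewrite ler_piMl// expr_le1// ltW.
  apply: (@le_trans _ _ 0); last by rewrite addr_ge0// !mulr_ge0// ltW.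
  by rewrite pmulr_rle0 ?exprn_gt0// ltW.
(* Absorbing [S / 2] leaves [S] at most twice the residual sum plus [16 * K * J]; [1 <= K] gives
   both parts the common factor [16 * K]. *)
have : \sum_(1 <= l < N.+1) F l <= K * \sum_(1 <= l < N.+1) F l.
  by rewrite ler_peMl.
rewrite mulrDr; lra.
Qed.

End broken_energy.

Theorem theorem3p2 (R : realType) (a b : R) (ltab : a < b)
    (kappa : R) (kappa_gt0 : 0 < kappa) (c0 : R)
    (eps : R) (eps_gt0 : 0 < eps) (eps_le1 : eps <= 1) :
  exists C : R, 0 < C /\
    forall W N : nat, (1 < N)%N -> N%:R = kappa * W%:R -> W%:R <= c0 / eps ->
    forall u : nat -> {poly R}, spectral_space W N u ->
      (\sum_(1 <= l < N.+1) sqnorm2eps eps (element a b N l) (horner (u l))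
        <= C%:E * Vhp a b eps N u)%E.
Proof.
have ba0 : 0 < b - a by rewrite subr_gt0.
(* Replacing [N] by its bound [kappa * (c0 / eps)] makes [K] independent of [W] and [N]; the
   absolute value ensures that [K] is positive. *)
pose K := (`|kappa * (c0 / eps)| / (b - a) + 1) / eps ^+ 4.
exists (16 * K); split.
  by rewrite mulr_gt0// divr_gt0 ?exprn_gt0// ltr_wpDl// divr_ge0// ltW.
move=> W N N1 NW Wc u _.
have NK : (N%:R / (b - a) + 1) / eps ^+ 4 <= K.
  rewrite ler_pM2r ?invr_gt0 ?exprn_gt0// lerD2r ler_pM2r ?invr_gt0//.
  by rewrite NW; apply: le_trans (ler_norm _); rewrite ler_pM2l.
have := sum_energy_le R a b eps N u K ltab eps_gt0 eps_le1 (ltnW N1) NK.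
rewrite -lee_fin; congr (_ <= _)%E.
  by rewrite -sumEFin; apply: eq_bigr => l _; rewrite sqnorm2eps_horner.
rewrite EFinM EFinD -sumEFin; congr (_ * (_ + _))%E.
by apply: eq_bigr => l _; rewrite Lop_horner L2norm_horner.
Qed.
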